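(* Let $q$ be a prime power and let $n,d,\ell$ be positive integers with $\ell\ge n$. Then $$A_q^{\mathrm{Lin}}(n,d)=\mathrm{val}\big(\mathrm{PartialKrawtchoukLP}_{\mathrm{Lin}}^{\mathbb{F}_q}(n,d,\ell)\big).$$ More precisely, every $\mathrm{GL}_\ell(\mathbb{F}_q)$-invariant optimum solution of $\mathrm{PartialKrawtchoukLP}_{\mathrm{Lin}}^{\mathbb{F}_q}(n,d,\ell)$ is integral.
   Context: $\mathbb{F}_q$ is the finite field with $q$ elements. For $w\in\mathbb{F}_q^n$, $|w|$ is the Hamming weight (number of nonzero coordinates), and $[d-1]=\{1,\dots,d-1\}$. A linear code of blocklength $n$ is a linear subspace $\mathcal{C}\le\mathbb{F}_q^n$; it has minimum distance at least $d$ if no $w\in\mathcal{C}$ has $|w|\in[d-1]$ (the zero code satisfies this vacuously). $A_q^{\mathrm{Lin}}(n,d)$ is the maximum cardinality of a linear code $\mathcal{C}\le\mathbb{F}_q^n$ of minimum distance at least $d$. For $\alpha\in\mathbb{F}_q^n$, $\chi_\alpha\colon\mathbb{F}_q^n\to\mathbb{C}$ is the additive character associated with $\alpha$, $\chi_\alpha(x)=\exp\big(2\pi i\,\mathrm{Tr}_{\mathbb{F}_q/\mathbb{F}_p}(\sum_k\alpha_kx_k)/p\big)$, where $p$ is the characteristic of $\mathbb{F}_q$, and $\mathbf{1}_\alpha\colon\mathbb{F}_q^n\to\{0,1\}$ is the indicator function of the point $\alpha$. For $x=(x_1,\dots,x_\ell)\in(\mathbb{F}_q^n)^\ell$, $\mathrm{span}(x)=\mathrm{span}(x_1,\dots,x_\ell)$.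 $\mathrm{PartialKrawtchoukLP}_{\mathrm{Lin}}^{\mathbb{F}_q}(n,d,\ell)$ is the following linear program in real variables $a_x$, $x\in(\mathbb{F}_q^n)^\ell$: maximize $\sum_{x_1\in\mathbb{F}_q^n}a_{(x_1,0,\dots,0)}$ subject to (1) $a_0=1$; (2) $a_{(x_1,\dots,x_\ell)}=0$ whenever there is $w\in\mathrm{span}(x_1,\dots,x_\ell)$ with $|w|\in[d-1]$; (3) (partial Fourier) $\sum_{x\in(\mathbb{F}_q^n)^\ell}a_x\theta_\alpha(x)\ge0$ for all $\alpha=(\alpha_1,\dots,\alpha_\ell)\in(\mathbb{F}_q^n)^\ell$ and all functions of the form $\theta_\alpha(x)=\prod_{i=1}^\ell\theta_{\alpha_i}(x_i)$ in which each $\theta_{\alpha_i}$ is chosen (independently for each index $i$) from $\{\chi_{\alpha_i},\mathbf{1}_{\alpha_i}\}$; (4) $a_x=a_y$ for all $x,y\in(\mathbb{F}_q^n)^\ell$ with $\mathrm{span}(x)=\mathrm{span}(y)$; (5) $a_x\ge0$ for all $x\in(\mathbb{F}_q^n)^\ell$. $\mathrm{val}(\cdot)$ denotes the optimum value of a linear program. A solution $a$ is $\mathrm{GL}_\ell(\mathbb{F}_q)$-invariant if $a_x=a_y$ whenever $\mathrm{span}(x)=\mathrm{span}(y)$ (equivalently, $a$ is invariant under the basis change action of $\mathrm{GL}_\ell(\mathbb{F}_q)$ on $\ell$-tuples); this is constraint (4). For a linear code $\mathcal{C}\le\mathbb{F}_q^n$, the true solution $a^{\mathcal{C}}$ is given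 by $a^{\mathcal{C}}_x=1$ if $x_j\in\mathcal{C}$ for all $j\in\{1,\dots,\ell\}$ and $a^{\mathcal{C}}_x=0$ otherwise. A solution $a$ is integral if it is a convex combination of true solutions $a^{\mathcal{C}}$, $\mathcal{C}\le\mathbb{F}_q^n$. *)

(* Defs.v *)
From HB Require Import structures.
From mathcomp Require Import all_boot all_order all_algebra all_field.
From mathcomp Require Import complex.
From mathcomp Require Import all_classical all_reals all_analysis.

Set Implicit Arguments.
Unset Strict Implicit.
Unset Printing Implicit Defensive.

Import Order.TTheory GRing.Theory Num.Theory.

Local Open Scope ring_scope.

(* {vspace vT} is a subtype of a type of square matrices, hence is finite over
   a finite field: this allows maxima and sums over all subspaces. *)
Section VspaceFinite.
Variables (F : finFieldType) (vT : vectType F).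
HB.instance Definition _ : isCountable {vspace vT} :=
  CanIsCountable (@VectorInternalTheory.vs2mxK F vT).
HB.instance Definition _ : fintype.isFinite {vspace vT} :=
  CanIsFinite (@VectorInternalTheory.vs2mxK F vT).
End VspaceFinite.

Section Codes.
Variables (F : finFieldType) (n : nat).

Definition hweight (w : 'rV[F]_n) : nat := #|[pred k | w 0 k != 0]|.

Definition min_dist_ge (d : nat) (C : {vspace 'rV[F]_n}) : bool :=
  [forall (w | w \in C), ~~ (1 <= hweight w <= d.-1)%N].

Definition A_Lin (d : nat) : nat :=
  \max_(C : {vspace 'rV[F]_n} | min_dist_ge d C) #|C|.

End Codes.

Section Characters.
Variables (R : realType) (F : finFieldType).

Definition fchar : nat := s2val (finPcharP F).

Definition fcharP : fchar \in [pchar F] := s2valP' (finPcharP F).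

(* The library's trace of F over its prime subfield, as an element of F:
   pPrimeCharType is F with its structure of extension of 'F_fchar. *)
Definition ftrace (x : F) : F :=
  galTrace 1%VS (fullv : {vspace pPrimeCharType fcharP}) x.

(* ftrace x lies in the prime subfield, so exactly one k is picked; it is read
   in 'F_fchar in order to be used as an integer between 0 and fchar - 1. *)
Definition ftrace_Fp (x : F) : 'F_fchar :=
  odflt 0 [pick k : 'F_fchar | (k : nat)%:R == ftrace x].

Definition cexpi (t : R) : R[i] := Complex (cos t) (sin t).

Definition addchar (n : nat) (alpha x : 'rV[F]_n) : R[i] :=
  cexpi (2 * pi * (ftrace_Fp (\sum_k alpha 0 k * x 0 k) : nat)%:R / fchar%:R).

Definition point_ind (n : nat) (alpha x : 'rV[F]_n) : R[i] := (x == alpha)%:R.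

End Characters.

Section PartialKrawtchoukLP.
Variables (R : realType) (F : finFieldType) (n d l : nat).

Local Notation V := 'rV[F]_n.
Local Notation variables := (l.-tuple V -> R).

Definition zero_tuple : l.-tuple V := [tuple 0 | i < l].

(* (x1, 0, ..., 0) *)
Definition first_tuple (x1 : V) : l.-tuple V :=
  [tuple (if (i : nat) == 0%N then x1 else 0) | i < l].

(* s i tells whether the i-th factor is a character or a point indicator. *)
Definition theta (s : {ffun 'I_l -> bool}) (alpha x : l.-tuple V) : R[i] :=
  \prod_(i < l) (if s i then addchar R (tnth alpha i) (tnth x i)
                 else point_ind R (tnth alpha i) (tnth x i)).

Definition GL_invariant (a : variables) : Prop :=
  forall x y : l.-tuple V, <<x>>%VS = <<y>>%VS -> a x = a y.

(* In R[i], 0 <= z means that z is real and nonnegative. *)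
Definition partial_fourier (a : variables) : Prop :=
  forall (alpha : l.-tuple V) (s : {ffun 'I_l -> bool}),
    0 <= \sum_(x : l.-tuple V) (a x)%:C%C * theta s alpha x.

Definition feasible (a : variables) : Prop :=
  [/\ a zero_tuple = 1,
      (forall x : l.-tuple V,
         (exists2 w, w \in <<x>>%VS & (1 <= hweight w <= d.-1)%N) -> a x = 0),
      partial_fourier a,
      GL_invariant a
    & (forall x, 0 <= a x)].

Definition objective (a : variables) : R := \sum_(x1 : V) a (first_tuple x1).

Definition val_LP : \bar R :=
  ereal_sup [set (objective a)%:E | a in feasible]%classic.

Definition optimum_solution (a : variables) : Prop :=
  feasible a /\ (forall b, feasible b -> objective b <= objective a).

Definition true_solution (C : {vspace V}) : variables :=
  fun x => if [forall j, tnth x j \in C] then 1 else 0.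

Definition integral_solution (a : variables) : Prop :=
  exists c : {vspace V} -> R,
    [/\ (forall C, 0 <= c C),
        \sum_(C : {vspace V}) c C = 1
      & (forall x, a x = \sum_(C : {vspace V}) c C * true_solution C x)].

End PartialKrawtchoukLP.

(* Main.v *)
Require Import Defs.
From mathcomp Require Import all_boot all_order all_fingroup all_algebra.
From mathcomp Require Import all_field complex.
From mathcomp Require Import all_classical all_reals all_analysis.
From mathcomp Require Import ring lra.

(* Since l >= n, every subspace is the span of some l-tuple, so an invariant a
   is a function of subspaces and Moebius inversion writes it uniquely as
   a = sum_C c(C) a^C with real coefficients c(C).  The Fourier test theta_alpha
   applied to a^C is a product over the coordinates, positive if alpha_i is in C
   for every indicator factor and in the dual of C for every character factor,
   and 0 otherwise.  For a given C0, take a basis of C0 for the indicators and a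
   basis of its dual for the characters (n vectors in all): only C = C0 passes,
   so the constraint reads c(C0) >= 0.  Moreover c(C) = 0 for C of distance less
   than d, by induction on the codimension of C, and sum_C c(C) = a_0 = 1.
   Hence every feasible solution is a convex combination of true solutions of
   admissible codes, and the objective is the average of their cardinalities. *)

Set Implicit Arguments.
Unset Strict Implicit.
Unset Printing Implicit Defensive.

Import Order.TTheory GRing.Theory Num.Theory.

Local Open Scope ring_scope.

Local Notation dot u v := (\sum_k u 0 k * v 0 k).

Lemma pchar_natr_eqmod (A : nzRingType) (p : nat) (chAp : p \in [pchar A])
    (m k : nat) : m%:R = k%:R :> A -> m = k %[mod p].
Proof.
wlog le_km : m k / (k <= m)%N => [IH emk|].
  by case/orP: (leq_total k m) => le; [|symmetry]; apply: IH => //.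
move=> emk; apply/eqP; rewrite eqn_mod_dvd // (dvdn_pcharf chAp) natrB //.
by rewrite emk subrr.
Qed.

(** * Additive characters and their sums over subspaces *)

Section Characters.
Variables (R : realType) (F : finFieldType).

Local Notation p := (fchar F).

Lemma fchar_prime : prime p.
Proof. exact: pcharf_prime (fcharP F). Qed.

Lemma ftraceD : {morph @ftrace F : x y / x + y}.
Proof. by move=> x y; rewrite /ftrace raddfD. Qed.

(** Dedekind independence: the sum of all automorphisms, each with coefficient 1, cannot vanish
    identically. *)
Lemma ftrace_neq0 : exists x : F, ftrace x != 0.
Proof.
pose L := pPrimeCharType (fcharP F).
have [c _ nzc] := @gal_independent_contra 'F_p L fullv
  [in 'Gal({:L} / 1)%g] (fun=> 1) 1%g (group1 _) (oner_neq0 _).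
exists c; congr (_ != 0): nzc.
by apply: eq_bigr => g _; rewrite mul1r.
Qed.

(** The default 0 in [ftrace_Fp] is never reached: the extension is Galois, so the trace lands in
    the prime subfield. *)
Lemma ftrace_FpE (x : F) : (ftrace_Fp x : nat)%:R = ftrace x.
Proof.
pose L := pPrimeCharType (fcharP F).
rewrite /ftrace_Fp; case: pickP => [k /eqP // | noP].
have /vlineP [k Dk] : galTrace 1%VS (fullv : {vspace L}) x \in 1%VS.
  by apply: mem_galTrace; [apply: finField_galois (sub1v _) | apply: memvf].
by have /eqP[] := noP k; rewrite /ftrace Dk; symmetry; apply: mulr1.
Qed.

Lemma ftrace_FpD (x y : F) :
  (ftrace_Fp (x + y) : nat) = (ftrace_Fp x + ftrace_Fp y)%N %[mod p].
Proof.
apply: (pchar_natr_eqmod (fcharP F)).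
by rewrite natrD !ftrace_FpE ftraceD.
Qed.

Lemma ftrace_Fp0 : ftrace_Fp (0 : F) = 0%N :> nat.
Proof.
have : (ftrace_Fp (0 : F) : nat) = 0%N %[mod p].
  apply: (pchar_natr_eqmod (fcharP F)); rewrite ftrace_FpE.
  by apply: (addrI (ftrace 0)); rewrite -ftraceD !addr0.
rewrite modn_small ?mod0n //.
by rewrite -[X in (_ < X)%N](Fp_cast fchar_prime).
Qed.

Lemma cexpiD (s t : R) : cexpi (s + t) = cexpi s * cexpi t.
Proof. by rewrite /cexpi cosD sinD; simpc; congr Complex; rewrite addrC. Qed.

Definition zeta_pow (m : nat) : R[i] :=
  cexpi (2 * pi * m%:R / p%:R).

Lemma zeta_powD (m k : nat) : zeta_pow (m + k) = zeta_pow m * zeta_pow k.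
Proof. by rewrite /zeta_pow -cexpiD natrD mulrDr mulrDl. Qed.

Lemma zeta_pow0 : zeta_pow 0 = 1.
Proof. by rewrite /zeta_pow mulr0 mul0r /cexpi cos0 sin0. Qed.

Lemma zeta_pow_mod (m : nat) : zeta_pow (m %% p) = zeta_pow m.
Proof.
have p_neq0 : p%:R != 0 :> R by rewrite pnatr_eq0 -lt0n prime_gt0 ?fchar_prime.
have rp1 : zeta_pow p = 1.
  by rewrite /zeta_pow mulfK // mulr_natl /cexpi cos2pi sin2pi.
rewrite [in RHS](divn_eq m p) zeta_powD; suff -> : zeta_pow (m %/ p * p) = 1.
  by rewrite mul1r.
elim: (m %/ p)%N => [|k IHk]; first by rewrite mul0n zeta_pow0.
by rewrite mulSn zeta_powD rp1 IHk mul1r.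
Qed.

(* cos (2 u) = 1 - 2 sin^2 u with u = pi m / p in (0, pi). *)
Lemma zeta_pow_neq1 (m : nat) : (0 < m < p)%N -> zeta_pow m != 1.
Proof.
case/andP=> m_gt0 lt_mp.
have p_gt0 : 0 < p%:R :> R by rewrite ltr0n prime_gt0 ?fchar_prime.
pose u : R := pi * m%:R / p%:R.
have u_pi : 0 < u < pi.
  apply/andP; split; first by rewrite divr_gt0 // mulr_gt0 ?pi_gt0 ?ltr0n.
  by rewrite ltr_pdivrMr // ltr_pM2l ?pi_gt0 // ltr_nat.
apply: contraTneq (sin_gt0_pi u_pi) => /(congr1 (@complex.Re R)) /=.
have -> : 2 * pi * m%:R / p%:R = u *+ 2 by rewrite -mulr_natl /u; ring.
rewrite cos_mulr2n cos2sin2 => cos1.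
have /eqP : sin u ^+ 2 = 0 by lra.
by rewrite sqrf_eq0 => /eqP ->; rewrite ltxx.
Qed.

Variable n : nat.
Local Notation V := 'rV[F]_n.
Implicit Types (alpha x y : V) (C : {vspace V}).

Lemma addcharE alpha x : addchar R alpha x = zeta_pow (ftrace_Fp (dot alpha x)).
Proof. by []. Qed.

Lemma addcharD alpha x y :
  addchar R alpha (x + y) = addchar R alpha x * addchar R alpha y.
Proof.
(* The representatives of the traces add only modulo the characteristic, which is all that
   [zeta_pow] sees. *)
rewrite !addcharE -zeta_powD -[RHS]zeta_pow_mod -ftrace_FpD zeta_pow_mod.
congr (zeta_pow (ftrace_Fp _)); rewrite -big_split /=.
by apply: eq_bigr => k _; rewrite mxE mulrDr.
Qed.

Lemma addchar_orthogonal alpha x : dot alpha x = 0 -> addchar R alpha x = 1.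
Proof. by rewrite addcharE => ->; rewrite ftrace_Fp0 zeta_pow0. Qed.

Lemma addchar_neq1 alpha y :
  dot alpha y != 0 -> exists c, addchar R alpha (c *: y) != 1.
Proof.
move=> y_neq0; have [t tr_neq0] := ftrace_neq0.
(* This scalar moves the dot product to [t], whose trace is nonzero. *)
exists (t / dot alpha y); rewrite addcharE.
have -> : dot alpha (t / dot alpha y *: y) = t.
  rewrite -[RHS](mulfVK y_neq0) mulr_sumr.
  by apply: eq_bigr => k _; rewrite mxE mulrCA.
apply: zeta_pow_neq1; apply/andP; split; last first.
  by rewrite -[X in (_ < X)%N](Fp_cast fchar_prime).
rewrite lt0n; apply: contraNneq tr_neq0 => tr0.
by rewrite -ftrace_FpE tr0.
Qed.

(** If C is not orthogonal to alpha, some z in C has character value other than 1. Translation by z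
    permutes C and multiplies the sum by that value, so the sum is 0. *)
Lemma sum_addchar C alpha :
  \sum_(x in C) addchar R alpha x =
  if [forall (x | x \in C), dot alpha x == 0] then #|C|%:R else 0.
Proof.
case: ifP => [/forall_inP orthC | /negbT].
  rewrite -sum1_card natr_sum; apply: eq_bigr => x /orthC /eqP.
  exact: addchar_orthogonal.
rewrite negb_forall_in => /exists_inP[y Cy /addchar_neq1[c]].
set z := c *: y; have Cz : z \in C by apply: memvZ.
move=> z_neq1; set S := \sum_(x in C) _.
have SE : S = addchar R alpha z * S.
  rewrite [LHS](reindex_inj (addrI z)) mulr_sumr; apply: eq_big => x.
    by rewrite rpredDl.
  by rewrite addcharD.
apply/eqP; rewrite -[_ == 0]orFb -(negbTE z_neq1) -[X in X || _]subr_eq0.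
by rewrite -mulf_eq0 mulrBl mul1r -SE subrr.
Qed.

End Characters.

(** * Moebius inversion and Fourier tests that isolate one subspace *)

Section Subspaces.
Variable F : finFieldType.

(* Moebius inversion on the lattice of subspaces. *)
Lemma vspace_upper_sum (vT : vectType F) (A : zmodType)
    (f : {vspace vT} -> A) :
  exists c : {vspace vT} -> A,
    forall U, f U = \sum_(C : {vspace vT} | (U <= C)%VS) c C.
Proof.
set N := \dim {:vT}.
(* The coefficients are built by increasing codimension: stage k settles all U of codimension less
   than k. *)
suff /(_ N.+1)[c fE] k : exists c : {vspace vT} -> A, forall U,
    (N < \dim U + k)%N -> f U = \sum_(C : {vspace vT} | (U <= C)%VS) c C.
  by exists c => U; apply: fE; rewrite addnS ltnS leq_addl.
elim: k => [|k [c fE]].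
  by exists (fun=> 0) => U; rewrite addn0 ltnNge dimvS ?subvf.
(* Settled values are kept. In codimension k the equation is solved for its diagonal term, the
   strictly larger subspaces being settled already. *)
pose c' C := if (N < \dim C + k)%N then c C
             else f C - \sum_(D : {vspace vT} | (C <= D)%VS && (D != C)) c D.
exists c' => U leU; case: (ltnP N (\dim U + k)) => [ltU | gtU].
  rewrite fE //; apply: eq_bigr => C sUC; rewrite /c' ifT //.
  by apply: leq_trans ltU _; rewrite leq_add2r dimvS.
have c'U : c' U = f U - \sum_(D : {vspace vT} | (U <= D)%VS && (D != U)) c D.
  by rewrite /c' ltnNge gtU.
rewrite (bigD1 U) ?subvv //= c'U.
rewrite -[LHS](subrK (\sum_(D : {vspace vT} | (U <= D)%VS && (D != U)) c D)).
congr (_ + _); apply: eq_bigr => C /andP[sUC neqCU]; rewrite /c' ifT //.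
rewrite addnS ltnS in leU; apply: leq_ltn_trans leU _.
rewrite ltn_add2r ltn_neqAle dimvS // andbT.
by apply: contraNneq neqCU => eqd; rewrite eq_sym eqEdim sUC eqd /=.
Qed.

Variable n : nat.
Local Notation V := 'rV[F]_n.
Implicit Types (C U : {vspace V}).

(** The projection onto C has row space C, and Gaussian elimination gives an invertible matrix whose
    first rows, as many as the rank, span it. The entries of [x *m invmx E] are the coordinates of x
    in the basis of rows of E. *)
Lemma subspace_frame C : exists (r : nat) (E : 'M[F]_n), E \in unitmx /\
  forall x, x \in C <-> forall j : 'I_n, (r <= j)%N -> (x *m invmx E) 0 j = 0.
Proof.
pose M := lin1_mx (projv C).
have memM x : (x \in C) = (x <= M)%MS.
  apply/idP/submxP => [Cx | [y ->]].
    by exists x; rewrite mul_rV_lin1 /= projv_id.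
  by rewrite mul_rV_lin1 memv_proj.
exists (\rank M), (row_ebase M); split=> [|x]; first exact: row_ebase_unit.
rewrite memM submxE /cokermx mulmxA mulmxBr mulmx1 subr_eq0.
move: (x *m _) => y; have pidE j : (y *m pid_mx (\rank M)) 0 j =
    if (j < \rank M)%N then y 0 j else 0.
  rewrite mxE (bigD1 j) //= big1 => [|i neq_ij].
    by rewrite addr0 mxE eqxx /=; case: ifP; rewrite (mulr1, mulr0).
  by rewrite mxE (negbTE (neq_ij : val i != val j)) mulr0.
split=> [/eqP yE j | y0].
  by rewrite leqNgt yE pidE => /negbTE ->.
apply/eqP/rowP => j; rewrite pidE; case: ltnP => // /y0 //.
Qed.

(** The condition for one factor of [theta] to have a nonzero sum over C, as [sum_theta_factor]
    shows; [b] marks a character factor. *)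
Definition factor_support C (b : bool) (beta : V) : bool :=
  if b then [forall (x | x \in C), dot beta x == 0] else beta \in C.

(** With a frame E of U, indicators at the first r rows of E force U into C. Characters at the
    remaining columns of [invmx E], which read off the coordinates vanishing on U, force C into
    U. *)
Lemma isolating_test (l : nat) (le_nl : (n <= l)%N) U :
  exists (s : {ffun 'I_l -> bool}) (alpha : l.-tuple V), forall C,
    [forall j, factor_support C (s j) (tnth alpha j)] = (C == U).
Proof.
have [r [E [uE memU]]] := subspace_frame U.
pose al (j : 'I_l) : V := if (insub (j : nat) : option 'I_n) is Some i then
  if (i < r)%N then row i E else (col i (invmx E))^T else 0.
exists [ffun j : 'I_l => ~~ (j < r)%N], [tuple al j | j < l] => C.
have alE (i : 'I_n) : al (widen_ord le_nl i) =
    if (i < r)%N then row i E else (col i (invmx E))^T.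
  rewrite /al /= insubT //= => lti.
  by rewrite (_ : Sub _ _ = i) //; apply: val_inj.
have dotE (i : 'I_n) (x : V) : dot ((col i (invmx E))^T) x = (x *m invmx E) 0 i.
  by rewrite mxE; apply: eq_bigr => k _; rewrite !mxE mulrC.
apply/forallP/eqP => [selC | -> j].
  apply/eqP; rewrite eqEsubv; apply/andP; split; apply/subvP => x.
    move=> Cx; apply/memU => i le_ri; have := selC (widen_ord le_nl i).
    rewrite /factor_support ffunE tnth_mktuple alE /= ltnNge le_ri /=.
    by move/forall_inP/(_ x Cx)/eqP; rewrite dotE.
  move/memU => Ux; rewrite -[x](mulmxKV uE) mulmx_sum_row.
  apply: rpred_sum => i _; case: (ltnP i r) => [lt_ir | /Ux ->].
    apply: rpredZ; have := selC (widen_ord le_nl i).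
    by rewrite /factor_support ffunE tnth_mktuple alE /= lt_ir.
  by rewrite scale0r mem0v.
rewrite /factor_support ffunE tnth_mktuple /al.
(* Positions from n on carry the zero vector, which passes both kinds of test for every subspace. *)
case: insubP => [i _ <- | _]; last first.
  case: ifP => _; last exact: mem0v.
  by apply/forall_inP => x _; rewrite big1 // => k _; rewrite mxE mul0r.
case: ltnP => /= [lt_ir | le_ri]; last first.
  by apply/forall_inP => x /memU Ux; rewrite dotE Ux.
apply/memU => k le_rk; rewrite -row_mul mulmxV // !mxE.
by case: eqP lt_ir => // ->; rewrite ltnNge le_rk.
Qed.

Lemma vspace_span_tuple (l : nat) (le_nl : (n <= l)%N) U :
  exists x : l.-tuple V, <<x>>%VS = U.
Proof.
(* Beyond the basis, the default 0 pads the tuple without changing its span. *)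
exists [tuple (vbasis U)`_i | i < l]; apply/eqP; rewrite eqEsubv.
apply/andP; split.
  apply/span_subvP => _ /tnthP[i ->]; rewrite tnth_mktuple.
  have [lti | gei] := ltnP i (size (vbasis U)).
    by apply: vbasis_mem; apply: mem_nth.
  by rewrite nth_default ?mem0v.
rewrite -{1}(span_basis (vbasisP U)); apply/span_subvP => v.
move=> /(nthP 0) [ i]; rewrite size_tuple => lti <-.
have ltil : (i < l)%N.
  apply: leq_trans lti (leq_trans (dimvS (subvf U)) _).
  by rewrite dimvf /dim /= mul1n.
apply: memv_span; apply/tnthP; exists (Ordinal ltil).
by rewrite tnth_mktuple.
Qed.

End Subspaces.

(** * Decomposition of feasible solutions into true solutions *)

Section Integrality.
Variables (R : realType) (F : finFieldType) (n l : nat).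
Local Notation V := 'rV[F]_n.
Implicit Types (C U : {vspace V}) (x : l.-tuple V).

Lemma card_vspace_gt0 C : (0 < #|C|)%N.
Proof. by apply/card_gt0P; exists 0; apply: mem0v. Qed.

Lemma sum_tuple_prod (G : 'I_l -> V -> R[i]) :
  \sum_(x : l.-tuple V) \prod_j G j (tnth x j) = \prod_j \sum_v G j v.
Proof.
pose tuple_of (f : {ffun 'I_l -> V}) := [tuple f j | j < l].
rewrite bigA_distr_bigA /= (reindex tuple_of) /=.
  by apply: eq_bigr => f _; apply: eq_bigr => j _; rewrite tnth_mktuple.
exists (fun x : l.-tuple V => [ffun j => tnth x j]) => [f | x] _.
  by apply/ffunP => j; rewrite ffunE tnth_mktuple.
by apply: eq_from_tnth => j; rewrite tnth_mktuple ffunE.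
Qed.

Definition theta_factor (b : bool) (beta v : V) : R[i] :=
  if b then addchar R beta v else point_ind R beta v.

Lemma sum_theta_factor C b beta :
  \sum_(v in C) theta_factor b beta v =
  (factor_support C b beta)%:R * (if b then #|C|%:R else 1).
Proof.
rewrite /theta_factor /factor_support; case: b; rewrite /= ?mulr1.
  by rewrite sum_addchar; case: ifP => _; rewrite (mul1r, mul0r).
case: (boolP (beta \in C)) => Cbeta.
  rewrite (bigD1 beta) //= big1 ?addr0 /point_ind ?eqxx // => v.
  by case/andP=> _ /negbTE ->.
apply: big1 => v Cv; rewrite /point_ind; case: eqP => // eqv.
by rewrite -eqv Cv in Cbeta.
Qed.

(** The true solution is the indicator of the l-th power of C, so the sum factors into l sums over
    C. *)
Lemma fourier_true_solution C (s : {ffun 'I_l -> bool}) (alpha : l.-tuple V) :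
  \sum_(x : l.-tuple V) (true_solution R C x)%:C%C * theta R s alpha x =
  [forall j, factor_support C (s j) (tnth alpha j)]%:R *
  \prod_j (if s j then #|C|%:R else 1).
Proof.
transitivity (\prod_j \sum_(v in C) theta_factor (s j) (tnth alpha j) v).
  under [RHS]eq_bigr do rewrite big_mkcond.
  rewrite -sum_tuple_prod; apply: eq_bigr => x _; rewrite /true_solution.
  case: ifP => [/forallP Cx | /negbT].
    by rewrite mul1r; apply: eq_bigr => j _; rewrite Cx.
  rewrite negb_forall => /existsP[j /negbTE Cxj].
  by rewrite mul0r (bigD1 j) //= Cxj mul0r.
under eq_bigr do rewrite sum_theta_factor.
rewrite big_split /=; congr (_ * _).
case: (boolP [forall j, _]) => [/forallP sel | ].
  by apply: big1 => j _; rewrite sel.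
rewrite negb_forall => /existsP[j /negbTE selj].
by rewrite (bigD1 j) //= selj mul0r.
Qed.

Lemma true_solutionE C x : true_solution R C x = (<<x>> <= C)%VS%:R.
Proof.
rewrite /true_solution; case: (boolP [forall j, _]) => [/forallP Cx | nCx].
  have -> // : (<<x>> <= C)%VS.
  by apply/span_subvP => _ /tnthP[j ->].
apply/esym/eqP; rewrite pnatr_eq0 eqb0; apply: contraNN nCx => /span_subvP sxC.
by apply/forallP => j; apply: sxC; apply: mem_tnth.
Qed.

Lemma true_solution_feasible (d : nat) C :
  min_dist_ge d C -> feasible d (true_solution R (l := l) C).
Proof.
move=> /forall_inP distC; split.
- rewrite /true_solution ifT //; apply/forallP => j.
  by rewrite tnth_mktuple mem0v.
- move=> x [w xw wd]; apply/eqP; rewrite true_solutionE pnatr_eq0 eqb0.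
  by apply: contraL wd => sxC; apply: distC; apply: subvP sxC _ xw.
- move=> alpha s; rewrite fourier_true_solution mulr_ge0 ?ler0n //.
  by apply: prodr_ge0 => j _; case: ifP; rewrite ?ler01 ?ler0n.
- by move=> x y eqxy; rewrite !true_solutionE eqxy.
- by move=> x; rewrite true_solutionE ler0n.
Qed.

Lemma objective_true_solution C (l_gt0 : (0 < l)%N) :
  objective (true_solution R (l := l) C) = #|C|%:R.
Proof.
rewrite /objective -sum1_card natr_sum [RHS]big_mkcond.
apply: eq_bigr => v _; rewrite /true_solution; congr (if _ then _ else _).
apply/forallP/idP => [/(_ (Ordinal l_gt0)) | Cv j]; rewrite tnth_mktuple //.
by case: ifP => // _; apply: mem0v.
Qed.

(** The convex combination gives integrality; the vanishing of [c] at codes of small distance serves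
    to bound the objective by [A_Lin]. *)
Lemma feasible_decomposition (d : nat) (le_nl : (n <= l)%N)
    (a : l.-tuple V -> R) : feasible d a ->
  exists c : {vspace V} -> R,
    [/\ forall C, 0 <= c C,
        \sum_(C : {vspace V}) c C = 1,
        forall C, ~~ min_dist_ge d C -> c C = 0
      & forall x, a x = \sum_(C : {vspace V}) c C * true_solution R C x].
Proof.
case=> a0 a_bad a_fourier a_GL _.
(* Choosing a spanning tuple for each subspace turns the invariant [a] into a function of
   subspaces. *)
have [pad padE] : exists pad : {vspace V} -> l.-tuple V,
    forall U, <<pad U>>%VS = U.
  apply: (fin_all_exists (P := fun U x => <<x>>%VS = U)) => U.
  exact: vspace_span_tuple.
have [c cE] := vspace_upper_sum (fun U => a (pad U)).
have aE x : a x = \sum_(C : {vspace V}) c C * true_solution R C x.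
  rewrite (a_GL x (pad <<x>>%VS)) ?padE // cE big_mkcond.
  by apply: eq_bigr => C _; rewrite true_solutionE mulr_natr mulrb.
exists c; split=> // [C0 | | ].
- have [s [alpha isoC]] := isolating_test le_nl C0.
  have := a_fourier alpha s.
  have -> : \sum_(x : l.-tuple V) (a x)%:C%C * theta R s alpha x =
      \sum_(C : {vspace V}) (c C)%:C%C *
        \sum_(x : l.-tuple V) (true_solution R C x)%:C%C * theta R s alpha x.
    under [RHS]eq_bigr do rewrite mulr_sumr.
    rewrite [RHS]exchange_big; apply: eq_bigr => x _.
    rewrite aE rmorph_sum mulr_suml; apply: eq_bigr => C _.
    by rewrite rmorphM mulrA.
  (* Only C0 passes the test, and its term is [c C0] times a positive number. *)
  rewrite (bigD1 C0) //= [X in _ + X]big1 ?addr0 => [|C neqC]; last first.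
    by rewrite fourier_true_solution isoC (negbTE neqC) mul0r mulr0.
  rewrite fourier_true_solution isoC eqxx mul1r pmulr_lge0; last first.
    apply: prodr_gt0 => j _; case: ifP => _; rewrite ?ltr01 //.
    by rewrite ltr0n card_vspace_gt0.
  by rewrite lecR.
- rewrite -a0 aE; apply: eq_bigr => C _; rewrite /true_solution ifT ?mulr1 //.
  by apply/forallP => j; rewrite tnth_mktuple mem0v.
have dimv_ltn (C D : {vspace V}) :
    (C <= D)%VS -> D != C -> (\dim C < \dim D)%N.
  move=> sCD; apply: contraNltn => leDC.
  by rewrite eq_sym eqEdim sCD.
(* Induction on codimension: every D above a bad C contains the same forbidden word, so its
   coefficient is already 0 and [a (pad C) = 0] reduces to [c C = 0]. *)
move=> C; have [k] := ubnP (\dim {:V} - \dim C)%N.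
elim: k C => // k IHk C leC badC.
have : a (pad C) = 0.
  move: badC; rewrite negb_forall_in => /exists_inP[w Cw]; rewrite negbK => wd.
  by apply: a_bad; exists w; rewrite ?padE.
rewrite cE (bigD1 C) ?subvv //= big1 ?addr0 // => D /andP[sCD neqDC].
apply: IHk.
  rewrite ltnS in leC; apply: leq_trans leC; apply: ltn_sub2l.
    by apply: leq_trans (dimvS (subvf D)); apply: dimv_ltn sCD neqDC.
  exact: dimv_ltn sCD neqDC.
apply: contra badC => /forall_inP distD; apply/forall_inP => w Cw.
by apply: distD; apply: subvP sCD _ Cw.
Qed.

End Integrality.

Theorem theorem4p4 (R : realType) (F : finFieldType) (n d l : nat)
    (n_gt0 : (0 < n)%N) (d_gt0 : (0 < d)%N) (l_gt0 : (0 < l)%N)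
    (n_le_l : (n <= l)%N) :
  ((A_Lin F n d)%:R%:E = val_LP R F n d l)%E /\
  (forall a : l.-tuple 'rV[F]_n -> R,
     optimum_solution d a -> GL_invariant a -> integral_solution a).
Proof.
split; last first.
  move=> a [feas_a _] _.
  have [c [c_ge0 c1 _ aE]] := feasible_decomposition n_le_l feas_a.
  by exists c.
apply/eqP; rewrite eq_le; apply/andP; split.
  (* The zero code is admissible, so the maximum defining [A_Lin] is attained, and the true solution
     of a largest code gives the lower bound. *)
  have dist0 : min_dist_ge d (0%VS : {vspace 'rV[F]_n}).
    apply/forall_inP => w; rewrite memv0 => /eqP ->.
    by rewrite /hweight eq_card0 // => k; rewrite inE mxE eqxx.
  have [C distC ->] : exists2 C : {vspace 'rV[F]_n},
      min_dist_ge d C & A_Lin F n d = #|C|.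
    have codes_gt0 : (0 < #|[pred C : {vspace 'rV[F]_n} | min_dist_ge d C]|)%N.
      by apply/card_gt0P; exists 0%VS.
    have [C distC AE] :=
      eq_bigmax_cond (fun C : {vspace 'rV[F]_n} => #|C|) codes_gt0.
    by exists C.
  apply: ereal_sup_ubound; exists (true_solution R C).
    exact: true_solution_feasible.
  by rewrite objective_true_solution.
apply: ge_ereal_sup => _ [a feas_a <-]; rewrite lee_fin.
have [c [c_ge0 c1 c_bad aE]] := feasible_decomposition n_le_l feas_a.
have -> : objective a = \sum_(C : {vspace 'rV[F]_n}) c C * #|C|%:R.
  rewrite /objective; under eq_bigr do rewrite aE.
  rewrite exchange_big; apply: eq_bigr => C _.
  by rewrite -(objective_true_solution R C l_gt0) mulr_sumr.
(* Since the weights sum to 1, [A_Lin] is its own weighted average and the comparison is made code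
   by code. *)
rewrite -[leRHS]mul1r -[X in _ <= X * _]c1 mulr_suml; apply: ler_sum => C _.
have [distC | /c_bad ->] := boolP (min_dist_ge d C); last by rewrite !mul0r.
apply: ler_wpM2l => //; rewrite ler_nat.
by rewrite /A_Lin (bigD1 C) // leq_maxl.
Qed.
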